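(* Let $M$ be a positive Archimedean monoid, and let $\mathcal{P}_{\mathrm{fin}}(M)$ be its finitary power monoid. Then the following statements hold. (1) If $M$ is an FFM, then $\mathcal{P}_{\mathrm{fin}}(M)$ is an FFM. (2) If $M$ is a TIDF-monoid, then $\mathcal{P}_{\mathrm{fin}}(M)$ is a TIDF-monoid.
   Context: All monoids are commutative and written additively, with identity $0$. A linearly ordered abelian group $G$ is Archimedean if for all nonzero $g,h \in G$ there is $n \in \mathbb{N}$ with $|g| \preceq n|h|$, where $|g| := \max\{g,-g\}$. A positive Archimedean monoid is a monoid isomorphic to a submonoid of the nonnegative cone $\{g \in G : 0 \preceq g\}$ of an Archimedean linearly ordered abelian group $G$. The finitary power monoid $\mathcal{P}_{\mathrm{fin}}(M)$ is the monoid of all nonempty finite subsets of $M$ under $S+T := \{s+t : s \in S, t \in T\}$. For a monoid $H$: $\mathcal{U}(H)$ is the group of invertible elements; $c$ divides $b$ in $H$ if $b = c+d$ for some $d \in H$; two elements are associates if they differ by adding an element of $\mathcal{U}(H)$. An atom is an element $a \in H \setminus \mathcal{U}(H)$ such that $a = b+c$ with $b,c \in H$ implies $b \in \mathcal{U}(H)$ or $c \in \mathcal{U}(H)$. $H$ is atomic if every non-invertible element is a finite sum of atoms. Let $H_{\mathrm{red}} := H/\mathcal{U}(H)$, let $\mathsf{Z}(H)$ be the free commutative monoid on the set of atoms of $H_{\mathrm{red}}$, and let $\pi : \mathsf{Z}(H) \to H_{\mathrm{red}}$ be the monoid homomorphism fixing the atoms. $H$ is a finite factorization monoid (FFM) if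 $H$ is atomic and $\pi^{-1}(b+\mathcal{U}(H))$ is finite for every $b \in H$. $H$ is Furstenberg if every non-invertible element is divisible by an atom; $H$ is an IDF-monoid if every element of $H$ is divisible by only finitely many atoms up to associates; $H$ is a TIDF-monoid if it is a Furstenberg IDF-monoid. *)

(* Defs.v *)
From HB Require Import structures.
From mathcomp Require Import all_boot all_order all_algebra.
From mathcomp Require Import finmap multiset.
From mathcomp Require Import boolp classical_sets functions cardinality.

Set Implicit Arguments.
Unset Strict Implicit.
Unset Printing Implicit Defensive.

Import Order.TTheory GRing.Theory Num.Theory.

Local Open Scope classical_set_scope.
Local Open Scope ring_scope.
Local Open Scope quotient_scope.

(* A monoid is an [nmodType]: a commutative monoid written additively. *)

HB.mixin Record isLinearlyOrderedGroup G of Num.POrderedZmodule G := {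
  log_le_total : total (<=%R : rel G);
  log_leD2r : forall z x y : G, x <= y -> x + z <= y + z
}.

#[short(type="linOrderedGroupType")]
HB.structure Definition LinearlyOrderedGroup :=
  {G of isLinearlyOrderedGroup G & Num.POrderedZmodule G}.

Definition log_abs (G : linOrderedGroupType) (g : G) : G := Num.max g (- g).

Definition archimedean_group (G : linOrderedGroupType) : Prop :=
  forall g h : G, g != 0 -> h != 0 ->
    exists n : nat, log_abs g <= log_abs h *+ n.

(* [N : addrClosed G] is a submonoid of [G], and [f] is an isomorphism of
   [M] onto it. *)
Definition positive_archimedean_monoid (M : nmodType) : Prop :=
  exists (G : linOrderedGroupType) (N : addrClosed G) (f : {additive M -> G}),
    [/\ archimedean_group G,
        {in N, forall g : G, 0 <= g}
      & set_bij [set: M] [set g | g \in N] f].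

Section FinitaryPowerMonoid.
Variable M : nmodType.

Record finpow := FinPow {
  finpow_fset :> {fset M};
  finpow_neq0 : finpow_fset != fset0
}.

HB.instance Definition _ := [isSub for finpow_fset].
HB.instance Definition _ := [Choice of finpow by <:].

Implicit Types S T : finpow.

Definition sumset (A B : {fset M}) : {fset M} :=
  [fset (s + t)%R | s in A, t in B]%fset.

Lemma sumsetP (A B : {fset M}) x :
  reflect (exists s t, [/\ s \in A, t \in B & x = s + t]) (x \in sumset A B).
Proof.
apply: (iffP idP) => [/imfset2P[s sA [t tB ->]]|[s [t [sA tB ->]]]].
  by exists s, t.
by apply/imfset2P; exists s => //; exists t.
Qed.

Lemma finpow0_subproof : [fset (0%R : M)]%fset != fset0.
Proof. by apply/fset0Pn; exists 0; rewrite inE. Qed.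

Lemma finpowD_subproof S T : sumset S T != fset0.
Proof.
have /fset0Pn[s sS] := finpow_neq0 S; have /fset0Pn[t tT] := finpow_neq0 T.
by apply/fset0Pn; exists (s + t); apply/sumsetP; exists s, t.
Qed.

Definition finpow0 : finpow := FinPow finpow0_subproof.
Definition finpowD S T : finpow := FinPow (finpowD_subproof S T).

Lemma finpowDA : associative finpowD.
Proof.
move=> A B C; apply/val_inj/fsetP => x /=; apply/sumsetP/sumsetP.
  move=> [a [_ [aA /sumsetP[b [c [bB cC ->]]] ->]]].
  by exists (a + b), c; split; rewrite ?addrA //; apply/sumsetP; exists a, b.
move=> [_ [c [/sumsetP[a [b [aA bB ->]]] cC ->]]].
by exists a, (b + c); split; rewrite ?addrA //; apply/sumsetP; exists b, c.
Qed.

Lemma finpowDC : commutative finpowD.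
Proof.
by move=> A B; apply/val_inj/fsetP => x /=; apply/sumsetP/sumsetP;
  move=> [a [b [aA bB ->]]]; exists b, a; rewrite addrC.
Qed.

Lemma finpow0D : left_id finpow0 finpowD.
Proof.
move=> A; apply/val_inj/fsetP => x /=; apply/sumsetP/idP.
  by move=> [z [a [/fset1P -> aA ->]]]; rewrite add0r.
by move=> xA; exists 0, x; rewrite add0r inE.
Qed.

HB.instance Definition _ :=
  GRing.isNmodule.Build finpow finpowDA finpowDC finpow0D.

End FinitaryPowerMonoid.

Section Divisibility.
Variable H : nmodType.
Implicit Types a b c d u : H.

Definition invertible u : Prop := exists v, u + v = 0.

Definition divides c b : Prop := exists d, b = c + d.

Definition associates b c : Prop := exists2 u, invertible u & c = b + u.

Definition atom a : Prop :=
  ~ invertible a /\ forall b c, a = b + c -> invertible b \/ invertible c.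

Definition atomic : Prop :=
  forall b, ~ invertible b ->
    exists2 s : seq H, {in s, forall a, atom a} & b = \sum_(a <- s) a.

Lemma invertible0 : invertible 0. Proof. by exists 0; rewrite addr0. Qed.

Lemma invertibleD u v : invertible u -> invertible v -> invertible (u + v).
Proof.
by move=> [u' uu'] [v' vv']; exists (u' + v'); rewrite addrACA uu' vv' addr0.
Qed.

Definition associatesb : rel H := fun b c => `[< associates b c >].

Lemma associatesb_equiv : equiv_class_of associatesb.
Proof.
have sym b c : associates b c -> associates c b.
  move=> [u [v uv] ->]; exists v; first by exists u; rewrite addrC.
  by rewrite -addrA uv addr0.
split=> [b|b c|c b d].
- by apply/asboolP; exists 0; [exact: invertible0|rewrite addr0].
- by apply/asboolP/asboolP => /sym.
- move=> /asboolP[u uU ->] /asboolP[v vU ->]; apply/asboolP.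
  by exists (u + v); [exact: invertibleD|rewrite addrA].
Qed.

Canonical associatesb_equiv_rel := EquivRelPack associatesb_equiv.
Canonical associatesb_encModRel := defaultEncModRel associatesb.

(* [reduced] is the monoid of cosets [b + U(H)], where [\pi_reduced b] is the
   coset of [b]. *)
Definition reduced := {eq_quot associatesb}.

HB.instance Definition _ : EqQuotient H associatesb reduced :=
  EqQuotient.on reduced.
HB.instance Definition _ := Choice.on reduced.

Definition reduced0 : reduced := lift_cst reduced 0.
Definition reducedD := lift_op2 reduced +%R.

Canonical pi_reduced0_morph := PiConst reduced0.

Lemma pi_reducedD : {morph \pi : b c / b + c >-> reducedD b c}.
Proof.
move=> b c; unlock reducedD; apply/esym/eqP; rewrite piE /= /associatesb.
have /eqP := reprK (\pi_reduced b); rewrite piE => /asboolP[u uU def_b].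
have /eqP := reprK (\pi_reduced c); rewrite piE => /asboolP[v vU def_c].
apply/asboolP; exists (u + v); first exact: invertibleD.
by rewrite addrACA -def_b -def_c.
Qed.

Canonical pi_reducedD_morph := PiMorph2 pi_reducedD.

Lemma reducedDA : associative reducedD.
Proof. by move=> b c d; rewrite -[b]reprK -[c]reprK -[d]reprK !piE addrA. Qed.

Lemma reducedDC : commutative reducedD.
Proof. by move=> b c; rewrite -[b]reprK -[c]reprK !piE addrC. Qed.

Lemma reduced0D : left_id reduced0 reducedD.
Proof. by move=> b; rewrite -[b]reprK !piE add0r. Qed.

HB.instance Definition _ :=
  GRing.isNmodule.Build reduced reducedDA reducedDC reduced0D.

End Divisibility.

Arguments atomic : clear implicits.

Section Factorizations.
Variable H : nmodType.

Definition reduced_atom := {a : reduced H | `[< atom a >]}.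
HB.instance Definition _ := Choice.on reduced_atom.

(* The free commutative monoid on the atoms of [reduced H]: its elements are
   the finite multisets of atoms, and its addition is the sum of multisets. *)
Definition factorizations := {mset reduced_atom}%mset.
HB.instance Definition _ := Choice.on factorizations.

Definition factorizationsD (x y : factorizations) : factorizations :=
  (x `+` y)%mset.

Lemma factorizationsDA : associative factorizationsD.
Proof. exact: msetDA. Qed.

Lemma factorizationsDC : commutative factorizationsD.
Proof. exact: msetDC. Qed.

Lemma factorizations0D : left_id (mset0 : factorizations) factorizationsD.
Proof. exact: mset0D. Qed.

HB.instance Definition _ := GRing.isNmodule.Build factorizations
  factorizationsDA factorizationsDC factorizations0D.

Lemma factorizationsDE (x y : factorizations) (a : reduced_atom) :
  (x + y) a = (x a + y a)%N.
Proof. by have xyE := msetE2 x y a; exact: xyE.1.1.1. Qed.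

Definition factorization_hom (z : factorizations) : reduced H :=
  \sum_(a <- finsupp z) val a *+ z a.

Lemma factorization_homE (z : factorizations) (A : {fset reduced_atom}) :
  (finsupp z `<=` A)%fset ->
  factorization_hom z = \sum_(a <- A) val a *+ z a.
Proof.
move=> zA; apply: big_fset_incl => // a _.
by rewrite memNfinsupp => /eqP ->; rewrite mulr0n.
Qed.

Lemma factorization_hom_is_nmod_morphism : nmod_morphism factorization_hom.
Proof.
split=> [|x y].
  by rewrite /factorization_hom finsupp0 big_seq_fset0.
pose A := (finsupp x `|` finsupp y)%fset.
rewrite !(@factorization_homE _ A) ?fsubsetUl ?fsubsetUr //.
  rewrite -big_split /=; apply: eq_bigr => a _.
  by rewrite factorizationsDE mulrnDr.
apply/fsubsetP => a; rewrite in_fsetU !mem_finsupp.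
by rewrite factorizationsDE addn_eq0 negb_and.
Qed.

HB.instance Definition _ := GRing.isNmodMorphism.Build factorizations
  (reduced H) factorization_hom factorization_hom_is_nmod_morphism.

Lemma factorization_hom_atom (a : reduced_atom) :
  factorization_hom [mset a]%mset = val a.
Proof.
rewrite (@factorization_homE _ [fset a]%fset) ?big_seq_fset1.
  by rewrite msetnxx.
by apply/fsubsetP => b; rewrite mem_finsupp msetnE inE; case: (b == a).
Qed.

Definition FFM : Prop :=
  atomic H /\
  forall b : H, finite_set [set z | factorization_hom z = \pi_(reduced H) b].

Definition furstenberg : Prop :=
  forall b : H, ~ invertible b -> exists2 a, atom a & divides a b.

(* The image under [\pi_(reduced H)] is the set of associate classes of the
   atoms dividing [b]. *)
Definition IDF_monoid : Prop :=
  forall b : H,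
    finite_set (\pi_(reduced H) @` [set a | atom a /\ divides a b]).

Definition TIDF_monoid : Prop := furstenberg /\ IDF_monoid.

End Factorizations.

(* Main.v *)
(* Call a monoid divisor-finite if each of its elements has finitely many
   divisors.  In a reduced unit-cancellative monoid this is equivalent to being
   an FFM, and it implies TIDF.  It passes from [M] to [finpow M]: if
   [S + T = B], then every element of [S] divides an element of [B].  Finally,
   a positive Archimedean TIDF-monoid is divisor-finite, because the finitely
   many atoms dividing [b] are bounded below by a positive element, which bounds
   the length of every factorization of a divisor of [b].  So a positive
   Archimedean monoid is TIDF if and only if it is an FFM, and both claims
   reduce to divisor-finiteness. *)

Require Import Defs.
From HB Require Import structures.
From mathcomp Require Import all_boot all_order all_algebra.
From mathcomp Require Import finmap multiset.
From mathcomp Require Import boolp classical_sets functions cardinality.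

Set Implicit Arguments.
Unset Strict Implicit.
Unset Printing Implicit Defensive.

Import Order.TTheory GRing.Theory Num.Theory.

Local Open Scope classical_set_scope.
Local Open Scope ring_scope.
Local Open Scope quotient_scope.

(** Such a multiset is determined by its restriction to [A], a map into ['I_n.+1]; the default value
    [0] of [g] is its multiplicity off [A]. *)
Lemma finite_bounded_mset (K : choiceType) (A : {fset K}) (n : nat) :
  finite_set [set z : {mset K}%mset |
    (finsupp z `<=` A)%fset /\ forall a, (z a <= n)%N].
Proof.
pose g (h : {ffun A -> 'I_n.+1}) : {mset K}%mset :=
  [fsfun a : A => (h a : nat) | 0%N].
apply: (@sub_finite_set _ _ (range g)); last first.
  by apply: finite_image; exact: finite_finset.
move=> z /= [zA zn]; exists [ffun a : A => inord (z (val a))] => //.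
apply/fsfunP => a; rewrite /g fsfun_ffun; case: insubP => [u _ <-|aNA].
  by rewrite /= ffunE inordK // ltnS.
apply/esym/eqP; rewrite -memNfinsupp; apply: contra aNA.
exact: (fsubsetP zA).
Qed.

Lemma mem_fset_setE (T : choiceType) (A : set T) (x : T) :
  finite_set A -> (x \in fset_set A) = `[< A x >].
Proof. by move=> finA; rewrite in_fset_set // inE. Qed.

(** * Divisibility in acyclic monoids *)

Section Acyclic.
Variable H : nmodType.
Implicit Types a b c d u x y z : H.

(* Equivalent to: [0] is the only invertible element and [x + y = x] forces
   [y = 0] (take [x = 0], resp. [z = 0]). *)
Definition acyclic : Prop := forall x y z, x + y + z = x -> y = 0.

Definition divisor_finite : Prop :=
  forall b, finite_set [set d | divides d b].

Lemma dividesD c b d : divides c b -> divides c (b + d).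
Proof. by move=> [e ->]; exists (e + d); rewrite addrA. Qed.

Lemma divides_trans c b d : divides d c -> divides c b -> divides d b.
Proof. by move=> [e ->] [e' ->]; exists (e + e'); rewrite addrA. Qed.

Lemma divides_refl b : divides b b.
Proof. by exists 0; rewrite addr0. Qed.

Hypothesis acyclicH : acyclic.

Lemma acyclic_addr_eq0 x y : x + y = 0 -> x = 0.
Proof. by move=> xy; apply: (acyclicH (x := 0) (z := y)); rewrite add0r. Qed.

Lemma acyclic_invertible u : invertible u <-> u = 0.
Proof. by split=> [[v /acyclic_addr_eq0]|->]; last exact: invertible0. Qed.

(** If [m < n] give the same value, then [x + y *+ m] absorbs [y] plus [y *+ (n - m.+1)], so
    acyclicity forces [y = 0]. *)
Lemma acyclic_mulrn_inj x y : y != 0 -> injective (fun n => x + y *+ n).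
Proof.
move=> y0; suff lt m n : (m < n)%N -> x + y *+ n = x + y *+ m -> False.
  by move=> m n; case: (ltngtP m n) => // /lt h /esym => [/h|/esym/h].
move=> mn; rewrite -(subnKC mn) addSn mulrS mulrnDr addrCA.
rewrite [x + _]addrA [y + _]addrCA => xy; move/eqP: y0; apply.
by apply: (acyclicH (x := x + y *+ m) (z := y *+ (n - m.+1))); rewrite -addrA.
Qed.

Lemma acyclic_divides_anti b c : divides b c -> divides c b -> b = c.
Proof.
move=> [d ->] [e be]; suff -> : d = 0 by rewrite addr0.
by apply: (acyclicH (x := b) (z := e)).
Qed.

End Acyclic.

(** * Divisor-finiteness, FFM and TIDF in an acyclic monoid *)

Section Reduced.
Variable H : nmodType.
Implicit Types a b c d u x y z : H.
Hypothesis acyclicH : acyclic H.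

(** The only unit is [0], so cosets are singletons and statements transfer between [H] and
    [reduced H]. *)
Lemma pi_inj : injective (\pi_(reduced H) : H -> reduced H).
Proof.
move=> b c /eqquotP /asboolP[u /(acyclic_invertible acyclicH) -> ->].
by rewrite addr0.
Qed.

Lemma piD b c : \pi_(reduced H) (b + c) = \pi_(reduced H) b + \pi_(reduced H) c.
Proof. exact: pi_reducedD. Qed.

Lemma pi0 : \pi_(reduced H) (0 : H) = 0.
Proof. by rewrite [RHS]piE. Qed.

Lemma reduced_acyclic : acyclic (reduced H).
Proof.
move=> x y z; rewrite -[x]reprK -[y]reprK -[z]reprK -!piD => /pi_inj.
by move=> /acyclicH ->; rewrite pi0.
Qed.

Lemma divides_pi (d : reduced H) b :
  divides d (\pi_(reduced H) b) -> divides (repr d) b.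
Proof.
move=> [e def_b]; exists (repr e); apply: pi_inj.
by rewrite piD !reprK.
Qed.

Lemma atom_pi a : atom a -> atom (\pi_(reduced H) a).
Proof.
move=> [a0 aP]; split.
  move=> [v]; rewrite -[v]reprK -piD -pi0 => /pi_inj av.
  by apply: a0; exists (repr v).
move=> b c; rewrite -[b]reprK -[c]reprK -piD => /pi_inj /aP.
by case=> /(acyclic_invertible acyclicH) ->; [left|right]; rewrite pi0;
  exact: invertible0.
Qed.

(** Induction on the number of divisors: if [b = x + y] with [y] not invertible, then [x] has
    strictly fewer divisors than [b], as [b] itself does not divide [x]. *)
Lemma divisor_finite_atomic : divisor_finite H -> atomic H.
Proof.
move=> finD b.
have [n] := ubnP #|` fset_set [set d | divides d b]|.
elim: n b => // n IHn b; rewrite ltnS => leDn b0.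
have [ab|nab] := pselect (atom b).
  exists [:: b]; last by rewrite big_seq1.
  by move=> x; rewrite inE => /eqP ->.
have [c [d [def_b c0 d0]]] :
    exists c d, [/\ b = c + d, ~ invertible c & ~ invertible d].
  apply: contrapT => nex; apply: nab; split=> // c d def_b.
  apply: contrapT => /not_orP[c0 d0]; apply: nex.
  by exists c, d.
have step x y : b = x + y -> ~ invertible x -> ~ invertible y ->
    exists2 s : seq H, {in s, forall a, atom a} & x = \sum_(a <- s) a.
  move=> bxy x0 y0; apply: IHn => //; apply: leq_trans leDn.
  have xb : divides x b by exists y.
  apply: fproper_ltn_card; rewrite fproperE; apply/andP; split.
    apply/fsubsetP => z; rewrite !mem_fset_setE // => /asboolP zx.
    by apply/asboolP; exact: divides_trans zx xb.
  apply/fsubsetPn; exists b; rewrite mem_fset_setE //.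
    exact/asboolP/divides_refl.
  apply/negP => /asboolP /(acyclic_divides_anti acyclicH) /(_ xb) bx.
  apply/y0/(acyclic_invertible acyclicH)/(acyclicH (x := x) (z := 0)).
  by rewrite addr0 -bxy.
have [s sA def_c] := step c d def_b c0 d0.
have [t tA def_d] := step d c (etrans def_b (addrC c d)) d0 c0.
exists (s ++ t); last by rewrite big_cat /= -def_c -def_d.
by move=> a; rewrite mem_cat => /orP[/sA|/tA].
Qed.

Lemma factorization_hom_multiplicity (w : factorizations H)
    (a : reduced_atom H) (n : nat) :
  (n <= w a)%N -> divides (val a *+ n) (factorization_hom w).
Proof.
move=> nwa; have [aw|] := boolP (a \in finsupp w); last first.
  rewrite memNfinsupp => /eqP wa0; move: nwa; rewrite wa0 leqn0 => /eqP ->.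
  by exists (factorization_hom w); rewrite mulr0n add0r.
rewrite /factorization_hom (big_fsetD1 a) //=.
apply: dividesD; exists (val a *+ (w a - n)).
by rewrite -mulrnDr subnKC.
Qed.

(** Atoms in a factorization [w] of [b] divide [b], so the supports lie in a fixed finite set. For
    such an atom [a], the multiples [val a *+ k] with [k < w a] are distinct divisors of [b], so
    [w a] is at most the number of divisors. *)
Lemma divisor_finite_FFM : divisor_finite H -> FFM H.
Proof.
move=> finD; split=> [|b]; first exact: divisor_finite_atomic.
have finX : finite_set [set d : reduced H | divides d (\pi_(reduced H) b)].
  apply: sub_finite_set (finite_image \pi_(reduced H) (finD b)) => d /= db.
  by exists (repr d); [exact: divides_pi|rewrite reprK].
have finA : finite_set [set a : reduced_atom H |
    divides (val a) (\pi_(reduced H) b)].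
  apply: (finite_preimage (f := val)) finX.
  by move=> x y _ _; exact: val_inj.
pose X := fset_set [set d : reduced H | divides d (\pi_(reduced H) b)].
apply: sub_finite_set (finite_bounded_mset (fset_set [set a : reduced_atom H |
    divides (val a) (\pi_(reduced H) b)]) #|` X|).
move=> w /= def_b; split=> [|a].
  apply/fsubsetP => a; rewrite mem_finsupp -lt0n => wa.
  rewrite mem_fset_setE //; apply/asboolP; rewrite /= -def_b.
  exact: (factorization_hom_multiplicity wa).
have a0 : val a != 0.
  by apply/eqP => a0; case/asboolP: (valP a) => + _; rewrite a0; apply;
    exact: invertible0.
suff : (size [seq (val a *+ k)%R | k <- iota 0 (w a)] <= #|` X|)%N.
  by rewrite size_map size_iota.
apply: uniq_leq_size.
  rewrite map_inj_uniq ?iota_uniq // => m n mn.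
  by apply: (acyclic_mulrn_inj reduced_acyclic (x := 0) a0); rewrite !add0r.
move=> x /mapP[k]; rewrite mem_iota add0n => /andP[_ kw] ->.
rewrite mem_fset_setE //; apply/asboolP; rewrite /= -def_b.
exact: factorization_hom_multiplicity (ltnW kw).
Qed.

Lemma factorization_hom_surj (x : reduced H) :
  atomic H -> exists w, factorization_hom w = x.
Proof.
move=> atomicH; have [x0|x0] := pselect (invertible (repr x)).
  exists 0; rewrite raddf0 -[x]reprK.
  by move/(acyclic_invertible acyclicH): x0 => ->; rewrite pi0.
have [s sA def_x] := atomicH _ x0; rewrite -[x]reprK def_x.
elim: s sA {def_x} => [|a s IHs] sA.
  by exists 0; rewrite raddf0 big_nil pi0.
have [|w def_w] := IHs; first by move=> b bs; apply: sA; rewrite inE bs orbT.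
have /atom_pi/asboolP aP : atom a by apply: sA; rewrite inE eqxx.
pose a' : reduced_atom H := exist _ (\pi_(reduced H) a) aP.
exists (([mset a']%mset : factorizations H) + w).
by rewrite raddfD /= factorization_hom_atom def_w big_cons piD.
Qed.

(** If [b = d + e], a factorization of [d] is a submultiset of one of [b], and it determines [d].
    There are finitely many factorizations of [b], each with finitely many submultisets. *)
Lemma FFM_divisor_finite : FFM H -> divisor_finite H.
Proof.
move=> [atomicH finF] b.
(* A finite set containing all submultisets of [v]: multiplicities are bounded uniformly by the
   largest one in [v]. *)
pose F (v : factorizations H) := [set z : {mset reduced_atom H}%mset |
  (finsupp z `<=` finsupp v)%fset /\
  forall p, (z p <= \max_(q <- finsupp v) v q)%N].
have finE : finite_set (\bigcup_(v in [set v : factorizations H |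
    factorization_hom v = \pi_(reduced H) b]) F v).
  by apply: bigcup_finite => // v _; exact: finite_bounded_mset.
apply: sub_finite_set (finite_image (repr \o @factorization_hom H) finE).
move=> d [e def_b].
have [x def_x] := factorization_hom_surj (\pi d) atomicH.
have [y def_y] := factorization_hom_surj (\pi e) atomicH.
exists x; last by apply: pi_inj; rewrite /= reprK def_x.
have le_xy p : (x p <= (x + y)%R p)%N by rewrite factorizationsDE leq_addr.
exists (x + y); first by rewrite /= raddfD /= def_x def_y -piD def_b.
split=> [|p].
  apply/fsubsetP => p; rewrite !mem_finsupp -!lt0n => xa.
  exact: leq_trans (le_xy p).
have [axy|] := boolP (p \in finsupp (x + y)); last first.
  rewrite memNfinsupp => /eqP xya0; apply: leq_trans (le_xy p) _.
  by rewrite xya0.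
apply: leq_trans (le_xy p) _.
exact: leq_bigmax_seq.
Qed.

Lemma divisor_finite_TIDF : divisor_finite H -> TIDF_monoid H.
Proof.
move=> finD; split=> [b b0|b]; last first.
  by apply/finite_image/(sub_finite_set _ (finD b)) => a [].
have [[|a s] sA def_b] := divisor_finite_atomic finD b0.
  by case: b0; rewrite def_b big_nil; exact: invertible0.
exists a; first by apply: sA; rewrite inE eqxx.
by rewrite def_b big_cons; exists (\sum_(c <- s) c).
Qed.

End Reduced.

(** * Transfer to the finitary power monoid *)

Section Finpow.
Variable M : nmodType.
Hypothesis acyclicM : acyclic M.

(* If [s \in S] and [t \in T] with [t != 0], then [S + T + U = S] makes the
   infinitely many elements [s + n t + n u] lie in the finite set [S]. *)
Lemma finpow_acyclic : acyclic (finpow M).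
Proof.
move=> S T U STU.
have /fset0Pn[s sS] := finpow_neq0 S; have /fset0Pn[u uU] := finpow_neq0 U.
have T0 t : t \in (T : {fset M}) -> t = 0.
  move=> tT; apply/eqP; apply: contrapT => /negP t0.
  have tu0 : t + u != 0.
    by apply: contra t0 => /eqP /(acyclic_addr_eq0 acyclicM) ->.
  have sn n : s + (t + u) *+ n \in (S : {fset M}).
    elim: n => [|n IHn]; first by rewrite mulr0n addr0.
    rewrite -STU; apply/sumsetP; exists (s + (t + u) *+ n + t), u; split=> //.
      by apply/sumsetP; exists (s + (t + u) *+ n), t.
    by rewrite mulrSr !addrA.
  suff : (size [seq (s + (t + u) *+ n)%R | n <- iota 0 #|` S|.+1] <= #|` S|)%N.
    by rewrite size_map size_iota ltnn.
  apply: uniq_leq_size => [|x /mapP[n _ ->]//].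
  by rewrite (map_inj_uniq (acyclic_mulrn_inj acyclicM tu0)) iota_uniq.
have /fset0Pn[t tT] := finpow_neq0 T.
apply/val_inj/fsetP => x; rewrite /= inE; apply/idP/eqP => [/T0//|->].
by rewrite -(T0 t tT).
Qed.

Lemma finpow_divisor_finite : divisor_finite M -> divisor_finite (finpow M).
Proof.
move=> finD B.
(* Every divisor of [B] is a subset of the finite set [E]. *)
pose E := \bigcup_(b in [set` (B : {fset M})]) [set d | divides d b].
have finE : finite_set E by apply: bigcup_finite => //; exact: finite_fset.
have finP : finite_set [set S : finpow M |
    finpow_fset S \in fpowerset (fset_set E)].
  apply: (finite_preimage (f := val)) (finite_fset (fpowerset (fset_set E))).
  by move=> S T _ _; exact: val_inj.
apply: sub_finite_set finP => S [T def_B] /=.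
rewrite fpowersetE; apply/fsubsetP => s sS; rewrite mem_fset_setE //.
have /fset0Pn[t tT] := finpow_neq0 T.
apply/asboolP; exists (s + t); last by exists t.
by rewrite /= def_B; apply/sumsetP; exists s, t.
Qed.

End Finpow.

(** * Positive Archimedean monoids *)

Section PositiveArchimedean.
Variables (G : linOrderedGroupType) (M : nmodType) (f : {additive M -> G}).
Implicit Types (g h : G) (a b c d x y : M).
Hypotheses (archG : archimedean_group G) (f_inj : injective f).
Hypothesis f_ge0 : forall x, 0 <= f x.

Lemma log_abs_ge0 g : 0 <= g -> log_abs g = g.
Proof.
move=> g0; rewrite /log_abs /Num.max; case: ifP => // /ltW gN.
have := log_leD2r g _ _ gN; rewrite addNr => gg0.
have := log_leD2r g _ _ g0; rewrite add0r => g_le.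
have : g = 0 by apply: le_anti; rewrite g0 (le_trans g_le).
by move=> ->; rewrite oppr0.
Qed.

(** Cancelling [f x] in [G] leaves [f y + f z = 0] with both terms nonnegative, so [f y = 0]. *)
Lemma positive_acyclic : acyclic M.
Proof.
move=> x y z /(congr1 f); rewrite !raddfD -addrA -[RHS]addr0 => /addrI yz0.
apply: f_inj; rewrite raddf0; apply: le_anti; rewrite f_ge0 andbT -yz0.
by have := log_leD2r (f y) _ _ (f_ge0 z); rewrite add0r addrC.
Qed.

Lemma exists_lower_bound g (s : seq G) : 0 < g -> {in s, forall h, 0 < h} ->
  exists2 e, 0 < e & {in g :: s, forall h, e <= h}.
Proof.
elim: s g => [|k s IHs] g g0 s0.
  by exists g => // h; rewrite inE => /eqP->.
have [|e e0 es] := IHs g g0.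
  by move=> h hs; apply: s0; rewrite inE hs orbT.
have [ek|ke] := orP (log_le_total e k).
  exists e => // h; rewrite !inE orbCA => /orP[/eqP->//|hs]; exact: es.
exists k => [|h]; first by apply: s0; rewrite inE eqxx.
rewrite !inE orbCA => /orP[/eqP->//|hs]; apply: le_trans ke _; exact: es.
Qed.

Lemma divides0_set : [set d : M | divides d 0] = [set 0].
Proof.
apply/seteqP; split=> [d [e /esym]|_ ->]; last exact: divides_refl.
exact: acyclic_addr_eq0 positive_acyclic _ _.
Qed.

(* If [e > 0] is a lower bound of the atoms dividing [b], then splitting such an
   atom off a divisor [c] of [b] decreases [f c] by at least [e]; hence the
   induction on [m] with [f c <= m e]. *)
Lemma TIDF_divisor_finite : TIDF_monoid M -> divisor_finite M.
Proof.
move=> [furM idfM] b.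
have [->|b0] := eqVneq b 0; first by rewrite divides0_set; exact: finite_set1.
have f_gt0 x : x != 0 -> 0 < f x.
  move=> x0; rewrite lt_neqAle f_ge0 andbT eq_sym.
  by apply: contra x0 => /eqP fx0; apply/eqP/f_inj; rewrite fx0 raddf0.
pose A := [set a | atom a /\ divides a b].
have finA : finite_set A.
  apply: sub_finite_set (finite_image repr (idfM b)) => a aA.
  exists (\pi_(reduced M) a); first by exists a.
  by apply: (pi_inj positive_acyclic); rewrite reprK.
(* Including [f b] keeps the list nonempty whatever [A] is. *)
have [|e e0 eP] := @exists_lower_bound (f b) [seq f a | a <- fset_set A]
    (f_gt0 b b0).
  move=> h /mapP[a]; rewrite mem_fset_setE // => /asboolP[[a0 _] _] ->.
  apply: f_gt0; apply/eqP => aE; apply: a0; rewrite aE; exact: invertible0.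
have eA a : A a -> e <= f a.
  move=> aA; apply: eP; rewrite inE; apply/orP; right; apply: map_f.
  by rewrite mem_fset_setE //; apply/asboolP.
have [n] : exists n, f b <= e *+ n.
  have [] := archG (g := f b) (h := e); rewrite ?gt_eqF ?f_gt0 // => n.
  by rewrite !log_abs_ge0 ?(ltW e0) //; exists n.
suff finD m c : divides c b -> f c <= e *+ m ->
    finite_set [set d | divides d c].
  exact/finD/divides_refl.
elim: m c => [|m IHm] c cb fc.
  suff -> : c = 0 by rewrite divides0_set; exact: finite_set1.
  by apply: f_inj; rewrite raddf0; apply: le_anti; rewrite f_ge0 andbT.
(* A nonzero divisor of [c] is an atom [a] of [A] plus a divisor of what remains of [c] once [a] is
   split off. *)
pose F a := [set a + d | d in [set d | exists y, c = a + (d + y)]].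
apply: (@sub_finite_set _ _ ([set 0] `|` \bigcup_(a in A) F a)).
  move=> d [y def_c]; have [->|d0] := eqVneq d 0; [by left|right].
  have [a aP [x def_d]] : exists2 a, atom a & divides a d.
    by apply: furM => /(acyclic_invertible positive_acyclic)/eqP; exact/negP.
  have cE : c = a + (x + y) by rewrite def_c def_d addrA.
  exists a; last by exists x => //; exists y.
  by split=> //; apply: divides_trans cb; exists (x + y).
rewrite finite_setU; split; first exact: finite_set1.
apply: bigcup_finite => // a aA; apply: finite_image.
have [[x def_c]|ac] := pselect (divides a c); last first.
  apply: sub_finite_set (@finite_set0 M) => d [y cE].
  by apply: ac; exists (d + y).
(* Cancellation in [G], pulled back along [f], shows that the remainder is exactly [x]. *)
apply: sub_finite_set (IHm x _ _) => [d [y]||].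
- rewrite def_c => /(congr1 f); rewrite !raddfD => /addrI.
  by rewrite -raddfD => /f_inj ->; exists y.
- by apply: divides_trans cb; exists a; rewrite addrC.
(* [f x <= f a + f x - e = f c - e <= e *+ m], by [e <= f a]. *)
have := log_leD2r (f x - e) _ _ (eA a aA).
rewrite addrC subrK => /le_trans; apply.
rewrite addrA -raddfD -def_c.
by have := log_leD2r (- e) _ _ fc; rewrite mulrSr addrK.
Qed.

End PositiveArchimedean.

Theorem corollary6p4 (M : nmodType) (hM : positive_archimedean_monoid M) :
  (FFM M -> FFM (finpow M)) /\ (TIDF_monoid M -> TIDF_monoid (finpow M)).
Proof.
have [G [N [f [archG N_ge0 [fN f_inj _]]]]] := hM.
have {}f_inj : injective f by move=> x y; apply: f_inj; rewrite inE.
have f_ge0 x : 0 <= f x by apply: N_ge0; exact: fN.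
have acM := positive_acyclic f_inj f_ge0; have acP := finpow_acyclic acM.
split=> [ffmM|tidfM].
  exact/(divisor_finite_FFM acP)/finpow_divisor_finite/(FFM_divisor_finite acM).
apply/(divisor_finite_TIDF acP)/finpow_divisor_finite.
exact: TIDF_divisor_finite archG f_inj f_ge0 tidfM.
Qed.
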